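(* (i) Let $\Lambda:\mathbb{R}\to(0,1]$ be decreasing. Then $\mathrm{ES}_\Lambda$ is quasi-convex, law invariant, satisfies $\mathrm{ES}_\Lambda\ge\mathrm{VaR}_\Lambda$ on $L^\infty$, and every quasi-convex, law-invariant $\rho:L^\infty\to\overline{\mathbb{R}}$ with $\rho\ge\mathrm{VaR}_\Lambda$ on $L^\infty$ satisfies $\rho\ge\mathrm{ES}_\Lambda$; i.e. $\mathrm{ES}_\Lambda=\min\{\rho:L^\infty\to\overline{\mathbb{R}}\mid\rho\ge\mathrm{VaR}_\Lambda\text{ and }\rho\text{ is quasi-convex and law invariant}\}$. (ii) Let $\Lambda:\mathbb{R}\to[0,1)$ be decreasing. Then $\mathrm{ES}_\Lambda=\min\{\rho:L^\infty\to\overline{\mathbb{R}}\mid\rho\ge\mathrm{VaR}^+_\Lambda\text{ and }\rho\text{ is quasi-convex and law invariant}\}$ in the same sense. Moreover, for every decreasing $\Lambda:\mathbb{R}\to[0,1]$, $$\mathrm{ES}_\Lambda(X)=\inf_{x\in\mathbb{R}}\left(\mathrm{ES}_{\Lambda(x)}(X)\vee x\right),\quad X\in L^\infty.$$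
   Context: $(\Omega,\mathcal F,\mathbb P)$ is an atomless probability space, $L^0$ the set of all random variables, $L^\infty$ the essentially bounded ones, $\overline{\mathbb{R}}=[-\infty,\infty]$; ''decreasing'' is in the weak sense; $\wedge=\min$, $\vee=\max$. For $\alpha\in[0,1]$, $X\in L^0$: $\mathrm{VaR}_\alpha(X)=\inf\{x\in\mathbb{R}:\mathbb P(X\le x)\ge\alpha\}$, $\mathrm{VaR}^+_\alpha(X)=\inf\{x\in\mathbb{R}:\mathbb P(X\le x)>\alpha\}$ ($\inf\mathbb{R}=-\infty$, $\inf\emptyset=\infty$). For $X\in L^\infty$: $\mathrm{ES}_\alpha(X)=\frac{1}{1-\alpha}\int_\alpha^1\mathrm{VaR}_\beta(X)\,\mathrm d\beta$ for $\alpha<1$, $\mathrm{ES}_1(X)=\mathrm{VaR}_1(X)$. For decreasing $\Lambda:\mathbb{R}\to[0,1]$: $\mathrm{VaR}_\Lambda(X)=\inf\{x\in\mathbb{R}:\mathbb P(X\le x)\ge\Lambda(x)\}$, $\mathrm{VaR}^+_\Lambda(X)=\inf\{x\in\mathbb{R}:\mathbb P(X\le x)>\Lambda(x)\}$, and the $\Lambda$-Expected Shortfall is $\mathrm{ES}_\Lambda(X)=\sup_{x\in\mathbb{R}}\left(\mathrm{ES}_{\Lambda(x)}(X)\wedge x\right)$, $X\in L^\infty$. Quasi-convex: $\rho(\gamma X+(1-\gamma)Y)\le\max\{\rho(X),\rho(Y)\}$ for all $X,Y$, $\gamma\in[0,1]$; law invariant: $\rho(X)=\rho(Y)$ when $X,Y$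 are equally distributed. $\rho\ge\widetilde\rho$ means pointwise on the common domain. *)

(* Defs.v *)
From HB Require Import structures.
From mathcomp Require Import all_boot all_order all_algebra.
From mathcomp Require Import all_classical all_reals all_analysis.
Set Implicit Arguments. Unset Strict Implicit. Unset Printing Implicit Defensive.
Import Order.TTheory GRing.Theory Num.Theory.
Import numFieldNormedType.Exports.
Local Open Scope classical_set_scope.
Local Open Scope ring_scope.

Section RiskMeasures.
Context {d : measure_display} {T : measurableType d} {R : realType}.
Variable P : probability T R.

Definition atomless : Prop :=
  forall A, measurable A -> (0 < P A)%E ->
    exists2 B, measurable B & (B `<=` A /\ (0 < P B)%E /\ (P B < P A)%E).

Definition Linf (X : T -> R) : Prop :=
  measurable_fun setT X /\ exists M : R, {ae P, forall t, `|X t| <= M}.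

Definition eq_distr (X Y : T -> R) : Prop :=
  forall B : set R, measurable B -> P (X @^-1` B) = P (Y @^-1` B).

(* VaR_alpha(X) = inf {x in R : P(X <= x) >= alpha}, in the extended reals
   (inf of the empty set = +oo, inf of R = -oo) *)
Definition VaR (alpha : R) (X : T -> R) : \bar R :=
  ereal_inf [set x%:E | x in [set x : R | (alpha%:E <= P [set t | (X t <= x)%R])%E]].

Definition VaRplus (alpha : R) (X : T -> R) : \bar R :=
  ereal_inf [set x%:E | x in [set x : R | (alpha%:E < P [set t | (X t <= x)%R])%E]].

Definition ES (alpha : R) (X : T -> R) : \bar R :=
  if alpha < 1 then
    (((1 - alpha)^-1)%:E *
      \int[lebesgue_measure]_(beta in `[alpha, 1%R]) VaR beta X)%E
  else VaR 1 X.

Definition VaR_L (L : R -> R) (X : T -> R) : \bar R :=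
  ereal_inf [set x%:E | x in [set x : R | ((L x)%:E <= P [set t | (X t <= x)%R])%E]].

Definition VaRplus_L (L : R -> R) (X : T -> R) : \bar R :=
  ereal_inf [set x%:E | x in [set x : R | ((L x)%:E < P [set t | (X t <= x)%R])%E]].

Definition ES_L (L : R -> R) (X : T -> R) : \bar R :=
  ereal_sup [set mine (ES (L x) X) x%:E | x in [set: R]].

Definition quasi_convex (rho : (T -> R) -> \bar R) : Prop :=
  forall X Y, Linf X -> Linf Y -> forall g : R, 0 <= g <= 1 ->
    (rho (fun t => (g * X t + (1 - g) * Y t)%R) <= maxe (rho X) (rho Y))%E.

Definition law_invariant (rho : (T -> R) -> \bar R) : Prop :=
  forall X Y, Linf X -> Linf Y -> eq_distr X Y -> rho X = rho Y.

Definition ge_on_Linf (rho rho' : (T -> R) -> \bar R) : Prop :=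
  forall X, Linf X -> (rho' X <= rho X)%E.

Definition is_min_qc_li_above (lb rho0 : (T -> R) -> \bar R) : Prop :=
  [/\ quasi_convex rho0, law_invariant rho0, ge_on_Linf rho0 lb &
      forall rho : (T -> R) -> \bar R,
        quasi_convex rho -> law_invariant rho -> ge_on_Linf rho lb ->
        ge_on_Linf rho rho0].

End RiskMeasures.

Definition decreasing {R : realType} (L : R -> R) : Prop :=
  forall x y : R, x <= y -> L y <= L x.

(* Main.v *)
(* For minimality, fix [x] and a real [y < min (ES_a X) x], where [a = L x], or
   some [a < L x] in (i) (ES is continuous in the level).  An atomless space
   carries a uniform variable [U], so [X] has the law of [q o U], [q] being the
   quantile function of [X].  Shifting [U] cyclically on [{U > a}] by multiples
   of [(1 - a) / n] gives [n] copies of [X] whose mean is at least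
   [ES_a X - 2 |X|_oo / n > y] on [{U > a}], by a Riemann sum comparison.  This
   mean is [<= y] with probability at most [a], hence its Lambda-VaR is at least
   [y], while quasi-convexity and law invariance keep its risk below that of [X].
   Quasi-convexity of ES comes from the Rockafellar-Uryasev formula
   [ES_a X = min_c (c + E (X - c)^+ / (1 - a))]. *)
Require Import Defs.
From HB Require Import structures.
From mathcomp Require Import all_boot all_order all_algebra.
From mathcomp Require Import all_classical all_reals all_analysis.
From mathcomp Require Import measurable_realfun zify ring lra.
Set Implicit Arguments. Unset Strict Implicit. Unset Printing Implicit Defensive.
Import Order.TTheory GRing.Theory Num.Theory.
Import numFieldNormedType.Exports.
Local Open Scope classical_set_scope.
Local Open Scope ring_scope.

(** * Atomless probability spaces *)

(** The competing [rho] carries no continuity, so [X] cannot be traded for the limiting variable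
    that equals [ES_a X] throughout [{U > a}]: quasi-convexity and law invariance only reach finite
    means of copies. Every finite mean loses something, which is why a real [y] strictly below the
    target is fixed beforehand and [n] is read off from the gap.

    Monotonicity of [L] turns one probability bound into a bound on the Lambda-VaR of the mean [Z]:
    for [z < y < x], [P (Z <= z) <= P (Z <= y) <= a], while [L z >= L x]. If [a = L x], this
    excludes [z] from the infimum in [VaRplus_L], whose condition is strict; the weak condition in
    [VaR_L] calls for [a < L x]. Since [a] has to lie in [[0, 1[], (i) asks for [L x > 0] and (ii)
    for [L x < 1]. *)

Section probability_values.
Context d (T : measurableType d) (R : realType) (P : probability T R).
Local Notation p A := (fine (P A)).

Lemma fine_probK A : measurable A -> (p A)%:E = P A.
Proof. by move=> mA; rewrite fineK// fin_num_measure. Qed.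

Lemma fine_prob_ge0 A : 0 <= p A.
Proof. exact: fine_ge0. Qed.

Lemma fine_prob_le1 A : measurable A -> p A <= 1.
Proof. by move=> mA; rewrite -lee_fin fine_probK// probability_le1. Qed.

Lemma fine_prob_le A B : measurable A -> measurable B -> A `<=` B -> p A <= p B.
Proof.
by move=> mA mB AB; rewrite -lee_fin !fine_probK// le_measure ?inE.
Qed.

Lemma fine_probD A B : measurable A -> measurable B -> A `<=` B ->
  p (B `\` A) = p B - p A.
Proof.
move=> mA mB AB; have mBA : measurable (B `\` A) by exact: measurableD.
apply: EFin_inj; rewrite EFinB !fine_probK// measureD// ?setIidr//.
by rewrite -ge0_fin_numE// fin_num_measure.
Qed.

Lemma fine_probU A B : measurable A -> measurable B -> [disjoint A & B] ->
  p (A `|` B) = p A + p B.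
Proof.
move=> mA mB /disj_set2P AB.
by apply: EFin_inj; rewrite EFinD !fine_probK// ?measureU//; exact: measurableU.
Qed.

Lemma fine_prob_bigcup_le (F : (set T)^nat) c :
  (forall n, measurable (F n)) -> nondecreasing_seq F ->
  (forall n, p (F n) <= c) -> p (\bigcup_n F n) <= c.
Proof.
move=> mF ndF Fc; have mU : measurable (\bigcup_n F n) by exact: bigcup_measurable.
rewrite -lee_fin fine_probK//.
have cvgF := @nondecreasing_cvg_mu _ _ _ P _ mF mU ndF.
rewrite -(cvg_lim _ cvgF)//; apply: lime_le; first exact: cvgP cvgF.
by apply: nearW => n /=; rewrite -fine_probK// lee_fin.
Qed.

(* Greedy: each step gains at least half of what could still be gained, so the
   gain available above the union is 0. *)
Lemma exhaustion A t : measurable A -> 0 <= t ->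
  exists S, [/\ measurable S, S `<=` A, p S <= t &
    forall S', measurable S' -> S `<=` S' -> S' `<=` A -> p S' <= t ->
      p S' <= p S].
Proof.
move=> mA t0.
pose adm S := [/\ measurable S, S `<=` A & p S <= t].
have /choice[f fP] : forall S, exists S', adm S -> [/\ adm S', S `<=` S' &
    forall S'', adm S'' -> S' `<=` S'' -> p S'' - p S' <= p S' - p S].
  (* [f] is made total by fixing inadmissible sets, so that it can be iterated. *)
  move=> S; have [admS|nadmS] := pselect (adm S); last by exists S.
  pose E := [set p S' | S' in [set S' | adm S' /\ S `<=` S']].
  have supE : has_sup E.
    split; first by exists (p S), S => //; split.
    by exists t; apply/ubP => _ [S' [[_ _ St] _] <-].
  have [Ss|sS] := ltP (p S) (sup E).
    have e0 : 0 < (sup E - p S) / 2 by lra.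
    have [_ [S' [admS' SS'] <-] S'e] := sup_adherent e0 supE.
    exists S' => _; split => // S'' admS'' S'S''.
    have : p S'' <= sup E.
      apply: ub_le_sup; first exact: (supE.2).
      by exists S'' => //; split => //; exact: subset_trans S'S''.
    lra.
  exists S => _; split => // S'' admS'' SS''.
  have : p S'' <= sup E by apply: ub_le_sup; [exact: (supE.2)|exists S''; split].
  lra.
pose S n := iter n f set0.
have admS n : adm (S n).
  elim: n => [|n IH] /=; first by split; rewrite ?measure0.
  by have [] := fP _ IH.
have ndS : nondecreasing_seq S.
  apply/nondecreasing_seqP => n; apply/subsetPset.
  by have [] := fP _ (admS n).
have mS n : measurable (S n) by have [] := admS n.
have mU : measurable (\bigcup_n S n) by exact: bigcup_measurable.
exists (\bigcup_n S n); split => //.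
- by move=> x [n _]; have [_ + _] := admS n; exact.
- by apply: fine_prob_bigcup_le => // n; have [] := admS n.
- move=> S' mS' US' S'A S't.
  (* The greedy choice reads [p (S n) <= 2 * p (S n.+1) - p S']; bounding [p (S n.+1)] by the union
     leaves a constant, so the bound passes to the union. *)
  suff : p (\bigcup_n S n) <= 2 * p (\bigcup_n S n) - p S' by lra.
  apply: fine_prob_bigcup_le => // n.
  have [_ _ /(_ S')] := fP _ (admS n).
  have S_U k : p (S k) <= p (\bigcup_n S n).
    by apply: fine_prob_le => //; exact: bigcup_sup.
  have := S_U n.+1; rewrite /= => + H.
  have : p S' - p (f (S n)) <= p (f (S n)) - p (S n).
    apply: H => //; apply: subset_trans US'.
    exact: (@bigcup_sup _ _ n.+1 _ S).
  lra.
Qed.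

Context (hP : atomless P).

(** Split repeatedly and keep the part with at most half of the mass. *)
Lemma atomless_small A (e : R) : measurable A -> 0 < p A -> 0 < e ->
  exists B, [/\ measurable B, B `<=` A, 0 < p B & p B <= e].
Proof.
move=> mA A0 e0.
have H n : exists B, [/\ measurable B, B `<=` A, 0 < p B & p B <= n.+1%:R^-1].
  elim: n => [|n [B [mB BA B0 Bn]]].
    by exists A; split => //; rewrite invr1 fine_prob_le1.
  have [|C mC [CB []]] := hP mB; first by rewrite -fine_probK.
  rewrite -(fine_probK mC) -(fine_probK mB) !lte_fin => C0 CltB.
  have mBC : measurable (B `\` C) by exact: measurableD.
  (* Halving beats the slow rate [1 / (n + 1)], for which the final index is just a truncation of
     [1 / e]. *)
  have hn : n.+1%:R^-1 / 2 <= n.+2%:R^-1 :> R.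
    rewrite -invfM lef_pV2 ?posrE ?mulr_gt0// -natrM ler_nat.
    by rewrite mulnS muln1 addnS ltnS leq_addr.
  move: (n.+1%:R^-1) (n.+2%:R^-1) Bn hn => a b Ba ab.
  have [C2|C2] := leP (p C) (p B / 2).
    by exists C; split => //; [exact: subset_trans BA|lra].
  exists (B `\` C); split => //; first by apply: subset_trans BA; exact: subDsetl.
    by rewrite fine_probD//; lra.
  by rewrite fine_probD//; lra.
have [B [mB BA B0 Be]] := H (Num.truncn e^-1).
exists B; split => //; apply: le_trans Be _.
by rewrite invf_ple ?posrE// ltW// truncnS_gt.
Qed.

(** Sierpinski's theorem: a maximal subset of mass below [t] could still be enlarged by a small
    piece of its complement in [A]. *)
Lemma atomless_subset A t : measurable A -> 0 <= t <= p A ->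
  exists S, [/\ measurable S, S `<=` A & p S = t].
Proof.
move=> mA /andP[t0 tA].
have [S [mS SA St Smax]] := exhaustion mA t0.
exists S; split => //; apply/eqP; rewrite eq_le St /= leNgt; apply/negP => Slt.
have mAS : measurable (A `\` S) by exact: measurableD.
have AS0 : 0 < p (A `\` S) by rewrite fine_probD//; lra.
have [|B [mB BAS B0 Bt]] := @atomless_small (A `\` S) (t - p S) mAS AS0.
  by lra.
have pSB : p (S `|` B) = p S + p B.
  rewrite fine_probU//; apply/disj_set2P/seteqP; split => // x [Sx /BAS[_]].
  exact.
have := Smax (S `|` B).
rewrite pSB => /(_ (measurableU _ _ mS mB) (@subsetUl _ _ _)) H.
suff : p S + p B <= p S by lra.
apply: H; last lra.
by move=> x [/SA//|/BAS[]].
Qed.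

Lemma atomless_between A B t : measurable A -> measurable B -> A `<=` B ->
  p A <= t <= p B ->
  exists S, [/\ measurable S, A `<=` S, S `<=` B & p S = t].
Proof.
move=> mA mB AB /andP[At tB].
have mBA : measurable (B `\` A) by exact: measurableD.
have [|S [mS SBA St]] := @atomless_subset (B `\` A) (t - p A) mBA.
  by rewrite fine_probD//; lra.
exists (A `|` S); split; first exact: measurableU.
- exact: subsetUl.
- by move=> x [/AB//|/SBA[]].
- rewrite fine_probU ?St//; first lra.
  by apply/disj_set2P/seteqP; split => // x [Ax /SBA[_]].
Qed.

End probability_values.

(** * Construction of a uniform random variable *)

Section uniform_variable.
Context d (T : measurableType d) (R : realType) (P : probability T R).
Local Notation p A := (fine (P A)).
Context (hP : atomless P).

(** [A n k] is the future sublevel set [{U <= k / 2 ^ n}] up to a null set. Each level keeps the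
    sets of the previous one at even indices and inserts at odd indices a set halving the mass in
    between. *)
Lemma dyadic_chain : exists A : nat -> nat -> set T, A 0%N 1%N = setT /\
  [/\ forall n k, measurable (A n k),
      forall n k l, (k <= l)%N -> A n k `<=` A n l,
      forall n k, A n.+1 k.*2 = A n k &
      forall n k, (k <= 2 ^ n)%N -> p (A n k) = k%:R / 2 ^+ n].
Proof.
pose chain (F : nat -> set T) :=
  (forall k, measurable (F k)) /\ (forall k, F k `<=` F k.+1).
have /choice[f fP] : forall F : nat -> set T, exists F' : nat -> set T,
    chain F -> [/\ chain F', forall k, F' k.*2 = F k &
      forall k, p (F' k.*2.+1) = (p (F k) + p (F k.+1)) / 2].
  move=> F; have [[mF sF]|nF] := pselect (chain F); last by exists F.
  have /choice[M MP] : forall k, exists S, [/\ measurable S, F k `<=` S,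
      S `<=` F k.+1 & p S = (p (F k) + p (F k.+1)) / 2].
    move=> k; apply: atomless_between => //.
    by have := fine_prob_le P (mF k) (mF k.+1) (sF k); lra.
  exists (fun j => if odd j then M j./2 else F j./2) => _.
  split; first split.
  - by move=> k; case: ifP => _ //; have [] := MP k./2.
  - move=> k; rewrite -[k.+1./2]/(uphalf k) uphalf_half /=.
    by case: (odd k) => /=; [rewrite add1n|rewrite add0n]; have [] := MP k./2.
  - by move=> k; rewrite odd_double doubleK.
  - by move=> k; rewrite /= odd_double /= uphalf_double; have [] := MP k.
pose A n := iter n f (fun k => if k is 0 then set0 else setT).
have chA n : chain (A n).
  elim: n => [|n IH]; first by split; case=> //= k; exact: measurableT.
  by have [] := fP _ IH.
exists A; split=> //; split.
- by move=> n k; have [] := chA n.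
- move=> n k l; elim: l => [|l IH]; first by rewrite leqn0 => /eqP ->.
  rewrite leq_eqVlt => /predU1P[-> //|]; rewrite ltnS => /IH kl.
  by apply: subset_trans kl _; have [_ sA] := chA n; exact: sA.
- by move=> n k; have [_ fD _] := fP _ (chA n); exact: fD.
- elim=> [|n IH] k.
    rewrite expr0 divr1; case: k => [|[|//]] _ /=; first by rewrite measure0.
    by rewrite probability_setT.
  have [_ fD fS] := fP _ (chA n).
  rewrite expnS mul2n -[k]odd_double_half; case: (odd k).
    rewrite add1n ltn_double => kn; have kn' := ltnW kn.
    rewrite -[A n.+1]/(f (A n)) fS !IH// exprS -addn1 -addnn !natrD.
    by field; rewrite expf_neq0.
  rewrite add0n leq_double => kn; rewrite -[A n.+1]/(f (A n)) fD IH// exprS -addnn natrD.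
  by field; rewrite expf_neq0.
Qed.

Lemma dyadic_eq (x y : R) :
  (forall n, x <= y + 1 / 2 ^+ n) -> (forall n, y <= x + 1 / 2 ^+ n) -> x = y.
Proof.
suff H a b : (forall n, a <= b + 1 / 2 ^+ n) -> a <= b :> R.
  by move=> xy yx; apply/eqP; rewrite eq_le !H.
move=> ab; rewrite leNgt; apply/negP => ba.
have e0 : 0 < a - b by lra.
have [N _ /(_ N (leqnn N))] := near_infty_natSinv_expn_lt (PosNum e0).
by have := ab N; rewrite /=; lra.
Qed.

(* [U] is the infimum of the dyadic levels [k / 2 ^ n] whose set contains the
   point. *)
Lemma uniform01_exists : exists U : T -> R, [/\ measurable_fun setT U,
  forall t, 0 <= U t <= 1 &
  forall s, 0 <= s <= 1 -> p [set t | U t <= s] = s].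
Proof.
have [A [A01 [mA sA A2 pA]]] := dyadic_chain.
have AX n m k : A (n + m)%N (k * 2 ^ m)%N = A n k.
  elim: m => [|m IH]; first by rewrite addn0 muln1.
  by rewrite addnS expnS mulnCA mul2n A2.
have dy n : (0 < 2 ^+ n :> R) by rewrite exprn_gt0.
have cmp n k m l : k%:R / 2 ^+ n <= l%:R / 2 ^+ m :> R -> A n k `<=` A m l.
  (* Both sets are moved to level [n + m], where their indices are comparable. *)
  rewrite ler_pdivrMr// mulrAC ler_pdivlMr// -!natrX -!natrM ler_nat => kl.
  by rewrite -(AX n m) -(AX m n) addnC; exact: sA.
pose E t := [set x : R | exists n k, A n k t /\ x = k%:R / 2 ^+ n].
have E1 t : E t 1 by exists 0%N, 1%N; rewrite A01 expr0 divr1.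
have E0 t : lbound (E t) 0.
  by move=> _ [n [k [_ ->]]]; rewrite divr_ge0// ltW.
have lbE t : has_lbound (E t) by exists 0; exact: E0.
pose U t := inf (E t).
have UA n k t : A n k t -> U t <= k%:R / 2 ^+ n.
  by move=> Akt; apply: ge_inf => //; exists n, k.
have AU n k t : U t < k%:R / 2 ^+ n -> A n k t.
  move=> /inf_lt[|_ [m [l [+ ->]] /ltW/cmp]]; first by exists 1; exact: E1.
  by move=> + H; exact: H.
have mU : measurable_fun setT U.
  apply: (measurability _ (RGenInftyO.measurableE R)) => //.
  move=> _ [_ [r ->] <-].
  rewrite setTI (_ : _ @^-1` _ = \bigcup_n \bigcup_k
      (if k%:R / 2 ^+ n < r then A n k else set0)).
    by do 2 apply: bigcup_measurable => ? _; case: ifP.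
  apply/seteqP; split => t /=; rewrite in_itv /=.
    move=> /inf_lt[|_ [m [l [At ->]] lr]]; first by exists 1; exact: E1.
    by exists m => //; exists l => //; rewrite lr.
  by move=> [n _ [k _]]; case: ifP => // kr /UA/le_lt_trans; exact.
exists U; split => // [t|s /andP[s0 s1]].
  apply/andP; split; last exact: ge_inf.
  by apply: lb_le_inf; [exists 1|].
have mUs : measurable [set t | U t <= s].
  have := mU measurableT `]-oo, s]%classic (measurable_itv _).
  by rewrite setTI; congr measurable; apply/seteqP; split => t /=; rewrite in_itv.
(* For [s = 1] the index [k.+1] used below would exceed [2 ^ n], where the mass of [A n k] is not
   given. *)
move: s1; rewrite le_eqVlt => /predU1P[s1|s1].
  rewrite (_ : [set t | _] = setT) ?probability_setT//.
  by apply/seteqP; split => // t _ /=; rewrite s1; exact: ge_inf.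
(* [{U <= s}] is squeezed between [A n k] and [A n k.+1], with [k] the integer part of
   [s * 2 ^ n]. *)
have bnd n : p [set t | U t <= s] <= s + 1 / 2 ^+ n /\
             s <= p [set t | U t <= s] + 1 / 2 ^+ n.
  have /truncn_itv/andP[] : 0 <= s * 2 ^+ n by rewrite mulr_ge0// ltW.
  set k := Num.truncn _ => ks sk.
  have kn : (k < 2 ^ n)%N.
    by rewrite -(ltr_nat R) (le_lt_trans ks)// natrX -ltr_pdivlMr// divff ?gt_eqF.
  have {}ks : k%:R / 2 ^+ n <= s by rewrite ler_pdivrMr.
  have {}sk : s < k.+1%:R / 2 ^+ n by rewrite ltr_pdivlMr.
  have le1 : p [set t | U t <= s] <= p (A n k.+1).
    by apply: fine_prob_le => // t /= Uts; apply: AU; exact: le_lt_trans sk.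
  have le2 : p (A n k) <= p [set t | U t <= s].
    by apply: fine_prob_le => // t /= /UA/le_trans; exact.
  move: le1 le2 sk; rewrite !pA//; last exact: ltnW.
  by rewrite -addn1 natrD mulrDl; lra.
by apply: dyadic_eq => n; have [] := bnd n.
Qed.

(** The value 0, taken on a null set only, is moved to 1, because quantiles are meaningful on []0,
    1]] alone. *)
Lemma uniform_exists : exists U : T -> R, [/\ measurable_fun setT U,
  forall t, 0 < U t <= 1 &
  forall s, 0 <= s <= 1 -> p [set t | U t <= s] = s].
Proof.
have [U [mU U01 pU]] := uniform01_exists.
have mUs s : measurable [set t | U t <= s].
  have := mU measurableT `]-oo, s]%classic (measurable_itv _).
  by rewrite setTI; congr measurable; apply/seteqP; split => t /=; rewrite in_itv.
exists (fun t => if U t <= 0 then 1 else U t); split.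
- apply: measurable_fun_ifT => //.
  apply: (measurable_fun_bool true).
  by rewrite setTI; exact: mUs.
- move=> t; case: (leP (U t) 0) => [_|->] /=; first by rewrite ltr01 lexx.
  by have /andP[] := U01 t.
- move=> s /andP[s0]; rewrite le_eqVlt => /predU1P[->|s1].
    rewrite (_ : [set t | _] = setT) ?probability_setT//.
    apply/seteqP; split => // t _ /=; case: ifP => // _.
    by have /andP[] := U01 t.
  rewrite (_ : [set t | _] = [set t | U t <= s] `\` [set t | U t <= 0]).
    rewrite fine_probD//; first by rewrite !pU ?subr0 ?lexx ?ler01//= s0 ltW.
    by move=> t /= /le_trans; exact.
  apply/seteqP; split => t /=.
    by case: ifP => [_|/negP]; [rewrite leNgt s1|].
  by move=> [Us /negP/negPf ->].
Qed.

End uniform_variable.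

(** * Quantile functions *)

Lemma eq_measure_rays (R : realType) (m1 m2 : {measure set R -> \bar R}) :
  (forall x, m1 `]x, +oo[%classic = m2 `]x, +oo[%classic) ->
  (forall x, (m1 `]x, +oo[%classic < +oo)%E) ->
  forall A, measurable A -> m1 A = m2 A.
Proof.
move=> m12 m1oo A mA.
apply: (measure_unique (@RGenOInfty.G R)
  (fun n => `](- n%:R), +oo[%classic)) => //.
- exact: RGenOInfty.measurableE.
- move=> _ _ [x ->] [y ->]; exists (Num.max x y).
  by apply/seteqP; split => z /=; rewrite !in_itv /= !andbT gt_max => /andP.
- by move=> n; exists (- n%:R).
- apply/seteqP; split => // x _; exists (Num.truncn `|x|).+1 => //=.
  rewrite in_itv /= andbT ltrNl (le_lt_trans _ (truncnS_gt _))//.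
  by rewrite -normrN ler_norm.
- by move=> _ [x ->].
Qed.

Lemma measurable_of_gt d (T : measurableType d) (R : realType)
    (D : set T) (X : T -> R) : measurable D ->
  (forall x, measurable (D `&` [set t | x < X t])) -> measurable_fun D X.
Proof.
move=> mD H.
apply: (measurability _ (RGenOInfty.measurableE R)) => //.
move=> _ [_ [x ->] <-]; rewrite (_ : _ @^-1` _ = [set t | x < X t]) //.
by apply/seteqP; split => t /=; rewrite in_itv /= andbT.
Qed.

Section quantile.
Context d (T : measurableType d) (R : realType) (P : probability T R).
Local Notation p A := (fine (P A)).
Local Notation mu := lebesgue_measure.

Lemma measurable_le_cst (X : T -> R) x : measurable_fun setT X ->
  measurable [set t | X t <= x].
Proof.
move=> mX; have := mX measurableT `]-oo, x]%classic (measurable_itv _).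
by rewrite setTI; congr measurable; apply/seteqP; split => t /=; rewrite in_itv.
Qed.

Definition cumulative (X : T -> R) x := p [set t | X t <= x].

(* [VaR P u X] is infinite for [u <= 0] and for [u > 1]; [0] is a junk value. *)
Definition quantile (X : T -> R) u := if 0 < u <= 1 then fine (VaR P u X) else 0.

Lemma quantile_out X u : ~~ (0 < u <= 1) -> quantile X u = 0.
Proof. by rewrite /quantile => /negbTE ->. Qed.

Lemma cumulative_le X x y : measurable_fun setT X -> x <= y ->
  cumulative X x <= cumulative X y.
Proof.
move=> mX xy; apply: fine_prob_le; [exact: measurable_le_cst..|].
by move=> t /= /le_trans; exact.
Qed.

Lemma cumulative_ge0 X x : 0 <= cumulative X x.
Proof. exact: fine_prob_ge0. Qed.

Lemma cumulative_le1 X x : measurable_fun setT X -> cumulative X x <= 1.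
Proof. by move=> mX; apply/fine_prob_le1/measurable_le_cst. Qed.

(** Right continuity of the distribution function: the events [{X > a + 1 / (n + 1)}] increase to
    [{X > a}]. *)
Lemma cumulative_rc X u a : measurable_fun setT X ->
  (forall x, a < x -> u <= cumulative X x) -> u <= cumulative X a.
Proof.
move=> mX H.
pose F n := ~` [set t | X t <= a + n.+1%:R^-1].
have mF n : measurable (F n) by apply: measurableC; exact: measurable_le_cst.
have pC x : p (~` [set t | X t <= x]) = 1 - cumulative X x.
  by rewrite -setTD fine_probD ?probability_setT//; exact: measurable_le_cst.
suff : p (~` [set t | X t <= a]) <= 1 - u by rewrite pC; lra.
have -> : ~` [set t | X t <= a] = \bigcup_n F n.
  apply/seteqP; split => t /=.
    move/negP; rewrite -ltNge => /ltr_add_invr[n an].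
    by exists n => //; apply/negP; rewrite -ltNge.
  move=> [n _ /negP]; rewrite -ltNge => aX; apply/negP; rewrite -ltNge.
  by apply: lt_trans aX; rewrite ltrDl.
apply: fine_prob_bigcup_le => //.
- apply/nondecreasing_seqP => n; apply/subsetPset => t /= /negP nX.
  apply/negP; rewrite -!ltNge in nX *; apply: le_lt_trans nX.
  by rewrite lerD2l lef_pV2 ?posrE// ler_nat.
- move=> n; rewrite pC; have := H (a + n.+1%:R^-1).
  by rewrite ltrDl invr_gt0 ltr0Sn => /(_ isT); lra.
Qed.

Section bounded.
Context (X : T -> R) (M : R).
Context (mX : measurable_fun setT X) (bX : {ae P, forall t, `|X t| <= M}).
Local Notation F := (cumulative X).
Local Notation q := (quantile X).

Lemma cumulative_eq1 : F M = 1.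
Proof.
apply/eqP; rewrite eq_le cumulative_le1//=.
have [A [mA A0 HA]] := bX.
suff : p (~` A) <= F M.
  by rewrite -setTD fine_probD// A0 probability_setT /= subr0.
apply: fine_prob_le; [exact: measurableC|exact: measurable_le_cst|].
move=> t At /=; rewrite leNgt; apply/negP => MX; apply: At; apply: HA => /=.
by move/(le_trans (ler_norm _)); rewrite leNgt MX.
Qed.

Lemma cumulative_eq0 x : x < - M -> F x = 0.
Proof.
move=> xM; apply/eqP; rewrite eq_le cumulative_ge0 andbT.
have [A [mA A0 HA]] := bX.
suff : F x <= p A by rewrite A0.
apply: fine_prob_le => //; first exact: measurable_le_cst.
move=> t /= Xx; apply: HA => /=; rewrite ler_norml => /andP[+ _].
by rewrite leNgt (le_lt_trans Xx).
Qed.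

(** Galois connection between quantiles and the distribution function. The essential bound makes the
    infimum real, and right continuity makes it attained. *)
Lemma VaR_quantile u : 0 < u <= 1 ->
  VaR P u X = (q u)%:E /\ forall x, (q u <= x) = (u <= F x).
Proof.
move=> u01; have /andP[u0 u1] := u01.
pose S := [set x | u <= F x].
have lbS : lbound S (- M).
  move=> x /= ux; rewrite leNgt; apply/negP => /cumulative_eq0 Fx0.
  by move: ux; rewrite /S /= Fx0 leNgt u0.
have S0 : S !=set0 by exists M; rewrite /S /= cumulative_eq1.
have VS : VaR P u X = (inf S)%:E.
  rewrite -ereal_inf_EFin//; last by exists (- M).
  rewrite /VaR; congr ereal_inf; apply/seteqP.
  by split => _ [x /= ux <-]; exists x => //=;
    move: ux; rewrite /S /= -(fine_probK P (measurable_le_cst x mX)) lee_fin.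
split; first by rewrite /quantile u01 VS.
move=> x; rewrite /quantile u01 VS /=; apply/idP/idP => [Sx|ux].
  apply: le_trans (cumulative_le mX Sx).
  apply: cumulative_rc => // y /inf_lt[//|z Sz zy].
  by apply: le_trans (cumulative_le mX (ltW zy)).
by apply: ge_inf => //; exists (- M).
Qed.

Lemma quantile_le u x : 0 < u <= 1 -> (q u <= x) = (u <= F x).
Proof. by move=> /VaR_quantile[_]. Qed.

Lemma quantile_itv u : 0 < u <= 1 -> - M <= q u <= M.
Proof.
move=> u01; have /andP[u0 u1] := u01; rewrite quantile_le// cumulative_eq1 u1.
rewrite andbT leNgt; apply/negP => /cumulative_eq0 Fq.
by have := lexx (q u); rewrite quantile_le// Fq leNgt u0.
Qed.

Lemma bound_ge0 : 0 <= M.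
Proof. by have /andP[] := @quantile_itv 1 (ltac:(by rewrite ltr01 lexx)); lra. Qed.

Lemma quantile_norm u : `|q u| <= M.
Proof.
have [u01|/quantile_out ->] := boolP (0 < u <= 1).
  by rewrite ler_norml quantile_itv.
by rewrite normr0 bound_ge0.
Qed.

Lemma quantile_mono u v : 0 < u -> u <= v -> v <= 1 -> q u <= q v.
Proof.
move=> u0 uv v1; have v01 : 0 < v <= 1 by rewrite v1 (lt_le_trans u0).
have u01 : 0 < u <= 1 by rewrite u0 (le_trans uv v1).
by rewrite quantile_le// (le_trans uv)// -quantile_le.
Qed.

Lemma measurable_quantile D : measurable_fun D q.
Proof.
apply: measurable_funTS; apply: measurable_of_gt => //  x; rewrite setTI.
(* The second set accounts for the junk value 0, which exceeds [x] exactly when [x < 0]. *)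
have -> : [set u | x < q u] = (`]0, 1] `&` `]F x, +oo[) `|`
    (if x < 0 then ~` `]0, 1] else set0) :> set R.
  apply/seteqP; split => u /=; rewrite !in_itv /= andbT.
    have [u01|u01] := boolP (0 < u <= 1).
      by rewrite ltNge quantile_le// -ltNge; left.
    rewrite quantile_out// => ->; right => /=.
    by rewrite in_itv /=; exact/negP.
  move=> [[u01]|]; first by rewrite !ltNge quantile_le.
  case: ifP => //= x0; rewrite in_itv /= => /negP u01.
  by rewrite quantile_out.
apply: measurableU; first by apply: measurableI; exact: measurable_itv.
by case: ifP => // _; apply: measurableC; exact: measurable_itv.
Qed.

Lemma quantile_integrable D : measurable D -> (mu D < +oo)%E ->
  mu.-integrable D (EFin \o q).
Proof.
move=> mD Doo; apply: measurable_bounded_integrable => //.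
  exact: measurable_quantile.
exists M; split; first exact: num_real.
by move=> y My u _ /=; apply: le_trans (quantile_norm u) (ltW My).
Qed.

Let probability_gt (Y : T -> R) x : measurable_fun setT Y ->
  P (Y @^-1` `]x, +oo[%classic) = (1 - cumulative Y x)%:E.
Proof.
move=> mY; rewrite (_ : _ @^-1` _ = setT `\` [set t | Y t <= x]).
  rewrite -fine_probK; last by apply: measurableD => //; exact: measurable_le_cst.
  by rewrite fine_probD ?probability_setT//; exact: measurable_le_cst.
apply/seteqP; split => t /=; rewrite in_itv /= andbT ltNge.
  by move/negP.
by move=> [_ /negP].
Qed.

Lemma eq_cumulative_distr (Y : T -> R) : measurable_fun setT Y ->
  (forall x, cumulative Y x = F x) -> eq_distr P X Y.
Proof.
move=> mY YF B mB.
pose X' : {mfun T >-> R} := HB.pack X (isMeasurableFun.Build _ _ _ _ X mX).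
pose Y' : {mfun T >-> R} := HB.pack Y (isMeasurableFun.Build _ _ _ _ Y mY).
apply: (@eq_measure_rays _ (distribution P X') (distribution P Y')) => // x.
- have := probability_gt x mY; rewrite YF => pY.
  exact: etrans (probability_gt x mX) (esym pY).
- by apply: (@le_lt_trans _ _ (1 - F x)%:E); [rewrite -probability_gt|exact: ltry].
Qed.

(** Inverse transform sampling: by the Galois connection, [{q o V <= x}] is [{V <= F x}]. *)
Lemma quantile_uniform_distr (V : T -> R) : measurable_fun setT V ->
  (forall t, 0 < V t <= 1) -> (forall s, 0 <= s <= 1 -> cumulative V s = s) ->
  eq_distr P X (q \o V).
Proof.
move=> mV V01 FV; apply: eq_cumulative_distr.
  by apply: measurableT_comp => //; exact: measurable_quantile.
move=> x; rewrite -[RHS]FV; last by rewrite cumulative_ge0 cumulative_le1.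
rewrite /cumulative; congr (fine (P _)); apply/seteqP.
by split => t /=; rewrite quantile_le.
Qed.

(** Change of variables: the law of [X] and the image under [q] of the uniform law on [[0, 1]] both
    give mass [1 - F x] to the ray []x, +oo[]. *)
Lemma ge0_integral_quantile (f : R -> R) : measurable_fun setT f ->
  (forall x, 0 <= f x) ->
  (\int[P]_t (f (X t))%:E = \int[mu]_(u in `]0%R, 1%R]) (f (q u))%:E)%E.
Proof.
move=> mf f0.
have mq : measurable_fun setT q by exact: measurable_quantile.
pose X' : {mfun T >-> R} := HB.pack X (isMeasurableFun.Build _ _ _ _ X mX).
pose q' : {mfun measurableTypeR R >-> R} :=
  HB.pack (q : measurableTypeR R -> R)
    (isMeasurableFun.Build _ _ (measurableTypeR R) R q mq).
pose U := uniform_prob (@ltr01 R).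
have unifE (g : R -> \bar R) : measurable_fun setT g -> (forall x, 0 <= g x)%E ->
    (\int[U]_x g x = \int[mu]_(x in `]0%R, 1%R]) g x)%E.
  move=> mg g0; rewrite integral_uniform// subr0 invr1 mul1e.
  by rewrite integral_itv_obnd_cbnd//; exact: measurable_funTS.
have Uray x : U (q @^-1` `]x, +oo[%classic) = (1 - F x)%:E.
  have mqx : measurable (q @^-1` `]x, +oo[%classic).
    by rewrite -[X in measurable X]setTI; exact: (mq measurableT).
  have -> : U (q @^-1` `]x, +oo[%classic) =
      (\int[U]_u (\1_(q @^-1` `]x, +oo[%classic) u)%:E)%E.
    by rewrite integral_indic// setIT.
  rewrite unifE//; last exact/measurable_EFinP/measurable_indic.
  rewrite integral_indic// (_ : _ `&` _ = `]F x, 1]%classic).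
    rewrite /= lebesgue_measure_itv /= lte_fin; case: ltP => //.
    by have := cumulative_le1 x mX => ? ?; congr EFin; lra.
  apply/seteqP; split => u /=; rewrite !in_itv /= andbT.
    by move=> [xq u01]; move: xq; rewrite ltNge quantile_le// -ltNge => ->;
      have /andP[] := u01.
  move=> /andP[Fu u1].
  have u01 : 0 < u <= 1 by rewrite u1 (le_lt_trans _ Fu) ?cumulative_ge0.
  by rewrite ltNge quantile_le// -ltNge.
have H A : measurable A -> distribution P X' A = distribution U q' A.
  apply: eq_measure_rays => x.
  - exact: etrans (probability_gt x mX) (esym (Uray x)).
  - by apply: (@le_lt_trans _ _ (1 - F x)%:E); [rewrite -probability_gt|exact: ltry].
rewrite -(unifE (fun u => (f (q u))%:E)); first last.
  - by move=> u; rewrite lee_fin.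
  - by apply/measurable_EFinP; exact: measurableT_comp.
have mEf : measurable_fun setT (fun y => (f y)%:E) by exact/measurable_EFinP.
have Ef0 y : (0 <= (f y)%:E)%E by rewrite lee_fin.
rewrite -[LHS](ge0_integral_distribution X' mEf Ef0).
rewrite -[RHS](ge0_integral_distribution (P := U) q' mEf Ef0).
by apply: eq_measure_integral => A mA _; exact: H.
Qed.

End bounded.
End quantile.

(** * Expected shortfall *)

Section expected_shortfall.
Context d (T : measurableType d) (R : realType) (P : probability T R).
Local Notation mu := lebesgue_measure.
Local Notation p A := (fine (P A)).

Definition tail_integral (X : T -> R) a := \int[mu]_(u in `]a, 1]) quantile P X u.

Definition shortfall (X : T -> R) a :=
  if a < 1 then (1 - a)^-1 * tail_integral X a else quantile P X 1.

(* Equal to [E (X - c)^+], see [stop_lossE]. *)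
Definition stop_loss (X : T -> R) c :=
  \int[mu]_(u in `]0, 1]) Num.max (quantile P X u - c) 0.

Section bounded.
Context (X : T -> R) (M : R).
Context (mX : measurable_fun setT X) (bX : {ae P, forall t, `|X t| <= M}).
Local Notation F := (cumulative P X).
Local Notation q := (quantile P X).

Let q_integrable a b : mu.-integrable `]a, b] (EFin \o q).
Proof.
apply: (quantile_integrable mX bX); first exact: measurable_itv.
by rewrite /= lebesgue_measure_itv /=; case: ifP => _; rewrite ?ltry.
Qed.

Let cst_integrable a b c : mu.-integrable `]a, b] (EFin \o (fun=> c : R)).
Proof.
apply: measurable_bounded_integrable => //.
  by rewrite /= lebesgue_measure_itv /=; case: ifP => _; rewrite ?ltry.
by exists `|c|; split => // y cy u _ /=; exact: ltW cy.
Qed.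

Let Rintegral_cst_itv a b c : a <= b ->
  \int[mu]_(u in `]a, b]) (c : R) = c * (b - a).
Proof.
move=> ab; rewrite Rintegral_cst; last exact: measurable_itv.
rewrite /= lebesgue_measure_itv /= lte_fin; case: ltP => //= ba.
by have -> : b = a by [apply/eqP; rewrite eq_le ab ba]; rewrite subrr.
Qed.

Lemma quantile_integral_ge a b m : a <= b ->
  (forall u, a < u <= b -> m <= q u) ->
  m * (b - a) <= \int[mu]_(u in `]a, b]) q u.
Proof.
move=> ab H; rewrite -Rintegral_cst_itv//; apply: le_Rintegral;
  [exact: measurable_itv|exact: cst_integrable|exact: q_integrable|].
by move=> u /=; rewrite in_itv /=; exact: H.
Qed.

Lemma quantile_integral_le a b m : a <= b ->
  (forall u, a < u <= b -> q u <= m) ->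
  \int[mu]_(u in `]a, b]) q u <= m * (b - a).
Proof.
move=> ab H; rewrite -Rintegral_cst_itv//; apply: le_Rintegral;
  [exact: measurable_itv|exact: q_integrable|exact: cst_integrable|].
by move=> u /=; rewrite in_itv /=; exact: H.
Qed.

Lemma quantile_integral_split a b c : a <= b -> b <= c ->
  \int[mu]_(u in `]a, c]) q u =
  \int[mu]_(u in `]a, b]) q u + \int[mu]_(u in `]b, c]) q u.
Proof.
move=> ab bc; rewrite -(@Rintegral_itvB _ q (BRight a) (BRight c) b)//.
by rewrite addrC subrK.
Qed.

(** The left endpoint of the integral has to be dropped first: for [a = 0] the integrand there is
    [VaR 0 X = -oo], whereas [q] is real. *)
Lemma ES_shortfall a : 0 <= a <= 1 -> ES P a X = (shortfall X a)%:E.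
Proof.
move=> /andP[a0 a1]; rewrite /ES /shortfall; case: ifPn => [alt1|].
  have VE u : u \in `]a, 1]%classic -> VaR P u X = (q u)%:E.
    rewrite inE /= in_itv /= => /andP[au u1].
    by have [] := VaR_quantile mX bX (_ : 0 < u <= 1);
      rewrite // u1 (le_lt_trans a0).
  rewrite -integral_itv_obnd_cbnd; last first.
    apply: (eq_measurable_fun (EFin \o q)); first by move=> u /VE ->.
    by apply/measurable_EFinP; exact: measurable_quantile bX _.
  have -> : (\int[mu]_(u in `]a, 1%R]) VaR P u X =
      \int[mu]_(u in `]a, 1%R]) (q u)%:E)%E by apply: eq_integral => u /VE ->.
  rewrite EFinM; congr (_ * _)%E; rewrite /tail_integral /Rintegral fineK//.
  by apply: integrable_fin_num => //; exact: measurable_itv.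
move=> _; by have [] := VaR_quantile mX bX (_ : 0 < 1 <= 1); rewrite // ltr01 lexx.
Qed.

Let max_integrable a b c :
  mu.-integrable `]a, b] (EFin \o (fun u => Num.max (q u - c) 0)).
Proof.
apply: measurable_bounded_integrable => //.
  by rewrite /= lebesgue_measure_itv /=; case: ifP => _; rewrite ?ltry.
  apply: measurable_maxr => //; apply: measurable_funB => //.
  exact: measurable_quantile bX _.
exists (M + `|c|); split; first exact: num_real.
move=> y My u _ /=; rewrite ger0_norm ?le_max ?lexx ?orbT//.
apply: le_trans (ltW My); rewrite ge_max addr_ge0 ?(bound_ge0 mX bX)//.
rewrite andbT lerD//; first exact: le_trans (ler_norm _) (quantile_norm mX bX u).
by rewrite -normrN ler_norm.
Qed.

Lemma stop_loss_split a c : 0 <= a <= 1 -> stop_loss X c =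
  \int[mu]_(u in `]0, a]) Num.max (q u - c) 0 +
  \int[mu]_(u in `]a, 1]) Num.max (q u - c) 0.
Proof.
move=> /andP[a0 a1]; rewrite /stop_loss.
rewrite -(@Rintegral_itvB _ (fun u => Num.max (q u - c) 0)
  (BRight 0) (BRight 1) a)//.
by rewrite addrC subrK.
Qed.

Lemma stop_loss_ge0 c : 0 <= stop_loss X c.
Proof. by apply: Rintegral_ge0 => u _; rewrite le_max lexx orbT. Qed.

(** Brings the stop-loss back to [T], where the positive part of a mixture of [X] and [Y] can be
    bounded pointwise; the quantile function of a mixture admits no such comparison. *)
Lemma stop_lossE c :
  (\int[P]_t (Num.max (X t - c) 0)%:E = (stop_loss X c)%:E)%E.
Proof.
rewrite (ge0_integral_quantile mX bX (f := fun x => Num.max (x - c) 0)).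
- rewrite /stop_loss /Rintegral fineK//.
  by apply: integrable_fin_num; [exact: measurable_itv|exact: max_integrable].
- by apply: measurable_maxr => //; exact: measurable_funB.
- by move=> x; rewrite le_max lexx orbT.
Qed.

(** Integrate [q <= c + (q - c)^+] over []a, 1]]; the rest of the stop-loss, over []0, a]], is
    nonnegative. *)
Lemma tail_integral_le a c : 0 <= a <= 1 ->
  tail_integral X a <= c * (1 - a) + stop_loss X c.
Proof.
move=> /andP[a0 a1]; rewrite (@stop_loss_split a c) ?a0//.
have H0 : 0 <= \int[mu]_(u in `]0, a]) Num.max (q u - c) 0.
  by apply: Rintegral_ge0 => u _; rewrite le_max lexx orbT.
suff : tail_integral X a <=
    c * (1 - a) + \int[mu]_(u in `]a, 1]) Num.max (q u - c) 0.
  by move=> /le_trans; apply; rewrite lerD2l lerDr.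
rewrite -Rintegral_cst_itv// -(RintegralD _
  (cst_integrable a 1 c) (max_integrable a 1 c))//.
apply: le_Rintegral => //.
  by apply: (integrableD _ (cst_integrable a 1 c) (max_integrable a 1 c)).
by move=> u _; rewrite -lerBlDl le_max lexx.
Qed.

(** Equality holds once [c] separates the values of [q] on []0, a]] from those on []a, 1]]. *)
Lemma tail_integral_attained a : 0 <= a <= 1 ->
  exists c, tail_integral X a = c * (1 - a) + stop_loss X c.
Proof.
move=> /andP[a0 a1].
have [c [cl cr]] : exists c, (forall u, 0 < u <= a -> q u <= c) /\
    (forall u, a < u <= 1 -> c <= q u).
  have [a_gt0|a_le0] := ltP 0 a.
    exists (q a); split => u /andP[u0 ua]; apply: (quantile_mono mX bX) => //.
    exact: ltW.
  (* For [a = 0] the value [q a] is junk, but any essential lower bound separates. *)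
  exists (- M); split => u /andP[u0 ua].
    by have := lt_le_trans u0 (le_trans ua a_le0); rewrite ltxx.
  have u01 : 0 < u <= 1 by rewrite ua (le_lt_trans a0).
  by have /andP[] := quantile_itv mX bX u01.
exists c; rewrite (@stop_loss_split a c) ?a0//.
have -> : \int[mu]_(u in `]0, a]) Num.max (q u - c) 0 = 0.
  rewrite -[RHS](mul0r (a - 0)) -Rintegral_cst_itv//; apply: eq_Rintegral => u.
  by rewrite inE /= in_itv /= => /cl qc; apply/max_idPr; rewrite subr_le0.
rewrite add0r -Rintegral_cst_itv// -(RintegralD _
  (cst_integrable a 1 c) (max_integrable a 1 c))//.
apply: eq_Rintegral => u; rewrite inE /= in_itv /= => /cr cq.
by rewrite (max_idPl _) ?subr_ge0// addrC subrK.
Qed.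

Lemma shortfall_ge a m : 0 <= a <= 1 ->
  (forall u, a < u <= 1 -> m <= q u) -> m <= q 1 -> m <= shortfall X a.
Proof.
move=> /andP[a0 a1] H H1; rewrite /shortfall; case: ltP => // alt1.
by rewrite mulrC ler_pdivlMr ?subr_gt0//; exact: quantile_integral_ge.
Qed.

Lemma shortfall_le_quantile1 a : 0 <= a <= 1 -> shortfall X a <= q 1.
Proof.
move=> /andP[a0 a1]; rewrite /shortfall; case: ltP => // alt1.
rewrite mulrC ler_pdivrMr ?subr_gt0//; apply: quantile_integral_le => //.
by move=> u /andP[au u1]; apply: (quantile_mono mX bX) => //; exact: le_lt_trans au.
Qed.

Lemma shortfall_le a c : 0 <= a < 1 ->
  shortfall X a <= c + stop_loss X c / (1 - a).
Proof.
move=> /andP[a0 a1]; have a1' : 0 < 1 - a by lra.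
rewrite /shortfall a1 [leLHS]mulrC ler_pdivrMr// mulrDl divfK ?gt_eqF//.
by rewrite tail_integral_le// a0 ltW.
Qed.

Lemma shortfall_attained a : 0 <= a < 1 ->
  exists c, shortfall X a = c + stop_loss X c / (1 - a).
Proof.
move=> /andP[a0 a1]; have a1' : 1 - a != 0 by rewrite gt_eqF// subr_gt0.
have [|c Hc] := @tail_integral_attained a; first by rewrite a0 ltW.
by exists c; rewrite /shortfall a1 Hc; field.
Qed.

(** The [c] that is optimal at level [b] is admissible at level [a], where the factor [1 / (1 - a)]
    is smaller. *)
Lemma shortfall_mono a b : 0 <= a -> a <= b -> b <= 1 ->
  shortfall X a <= shortfall X b.
Proof.
move=> a0 + b1; move: b1; rewrite le_eqVlt => /predU1P[->|b1] ab.
  rewrite [X in _ <= X]/shortfall ltxx.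
  by rewrite shortfall_le_quantile1// a0.
have [|c ->] := @shortfall_attained b; first by rewrite b1 (le_trans a0).
apply: (le_trans (@shortfall_le a c _)); first by rewrite a0 (le_lt_trans ab).
rewrite lerD2l ler_wpM2l ?stop_loss_ge0// lef_pV2 ?posrE; lra.
Qed.

(** Supplies the level strictly below [L x] that (i) calls for. *)
Lemma shortfall_lsc a y : 0 < a <= 1 -> y < shortfall X a ->
  exists b, [/\ 0 <= b, b < a & y < shortfall X b].
Proof.
move=> /andP[a0]; rewrite le_eqVlt => /predU1P[->|a1] ye.
  (* At level 1 the shortfall is [q 1], so [F y < 1], and every quantile of level above the midpoint
     of [F y] and 1 exceeds [y]. *)
  have Fy1 : F y < 1.
    move: ye; rewrite /shortfall ltxx ltNge => /negP H; rewrite ltNge; apply/negP.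
    by rewrite -(quantile_le mX bX) ?ltr01 ?lexx.
  have F0 := cumulative_ge0 P X y.
  pose b := (F y + 1) / 2.
  have bb : [/\ 0 < b, b < 1 & F y < b] by rewrite /b; split; lra.
  case: bb => b0 b1 Fb; exists b; split => //; first exact: ltW.
  have b01 : 0 < b <= 1 by rewrite b0 ltW.
  have qb : y < q b by rewrite ltNge (quantile_le mX bX)// -ltNge.
  apply: (lt_le_trans qb); apply: shortfall_ge.
  - by rewrite !ltW.
  - by move=> u /andP[bu u1]; apply: (quantile_mono mX bX) => //; exact: ltW.
  - by apply: (quantile_mono mX bX) => //; exact: ltW.
have M0 := bound_ge0 mX bX.
set e := shortfall X a in ye *.
have eE : tail_integral X a = (1 - a) * e.
  by rewrite /e /shortfall a1 mulrA divff ?mul1r// gt_eqF// subr_gt0.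
(* Lowering the level by [h] costs at most [h * (M + y)], to be paid from the slack
   [(1 - a) * (e - y)]. [K] is a positive bound of [M + y], and [h <= a] keeps the level
   nonnegative. *)
pose K := M + `|y| + 1.
have K0 : 0 < K by rewrite /K; have := normr_ge0 y; lra.
pose h := Num.min a ((1 - a) * (e - y) / (2 * K)).
have h0 : 0 < h.
  by rewrite lt_min a0 divr_gt0 ?mulr_gt0//; lra.
have ha : h <= a by rewrite ge_min lexx.
have hK : h * (2 * K) <= (1 - a) * (e - y).
  by rewrite -ler_pdivlMr ?mulr_gt0// ge_min lexx orbT.
exists (a - h); split; [lra|lra|].
have lt1 : a - h < 1 by lra.
rewrite /shortfall lt1 mulrC ltr_pdivlMr; last lra.
rewrite /tail_integral (@quantile_integral_split _ a) -/(tail_integral X a); [|lra|lra].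
rewrite eE.
have Hl : (- M) * (a - (a - h)) <= \int[mu]_(u in `]a - h, a]) q u.
  apply: quantile_integral_ge; first lra.
  move=> u /andP[u1 u2].
  have u01 : 0 < u <= 1 by apply/andP; split; lra.
  by have /andP[] := quantile_itv mX bX u01.
move: (\int[mu]_(u in `]a - h, a]) q u) Hl => J Hl.
have yy : y <= `|y| := ler_norm y.
have : h * M + h * y < h * (2 * K).
  by rewrite -mulrDr ltr_pM2l// /K; have := normr_ge0 y; lra.
lra.
Qed.

End bounded.

Lemma LinfD X Y g : Linf P X -> Linf P Y ->
  Linf P (fun t => g * X t + (1 - g) * Y t).
Proof.
move=> [mX [M bX]] [mY [N bY]]; split.
  by apply: measurable_funD; apply: measurable_funM.
exists (`|g| * M + `|1 - g| * N); apply: filterS2 bX bY => t Xt Yt.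
apply: (le_trans (ler_normD _ _)).
by rewrite !normrM lerD// ler_wpM2l.
Qed.

(** In fact convexity is shown. For [a < 1], the same mixture of the constants optimal for [X] and
    [Y] is inserted into the bound for [W], and the positive part is convex. *)
Lemma shortfall_quasi_convex a X Y g : 0 <= a <= 1 -> Linf P X -> Linf P Y ->
  0 <= g <= 1 -> shortfall (fun t => g * X t + (1 - g) * Y t) a <=
    Num.max (shortfall X a) (shortfall Y a).
Proof.
move=> /andP[a0 a1] LX LY /andP[g0 g1].
have [mW [K bW]] := LinfD g LX LY.
have [mX [M bX]] := LX; have [mY [N bY]] := LY.
set W := fun t => _ in mW bW *.
have convex_le x y : g * x + (1 - g) * y <= Num.max x y.
  have : g * x <= g * Num.max x y by rewrite ler_wpM2l// le_max lexx.
  have : (1 - g) * y <= (1 - g) * Num.max x y.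
    by rewrite ler_wpM2l ?subr_ge0// le_max lexx orbT.
  lra.
apply: le_trans (convex_le _ _).
move: a1; rewrite le_eqVlt => /predU1P[->|a1].
  rewrite /shortfall !ltxx (quantile_le mW bW) ?ltr01 ?lexx//.
  have H01 : 0 < (1 : R) <= 1 by rewrite ltr01 lexx.
  have FX : 1 <= cumulative P X (quantile P X 1) by rewrite -(quantile_le mX bX).
  have FY : 1 <= cumulative P Y (quantile P Y 1) by rewrite -(quantile_le mY bY).
  set x := quantile P X 1 in FX *; set y := quantile P Y 1 in FY *.
  set A := [set t | X t <= x]; set B := [set t | Y t <= y].
  have mA : measurable A by exact: measurable_le_cst.
  have mB : measurable B by exact: measurable_le_cst.
  (* At level 1 the shortfall is the essential supremum, and two events of full mass meet in one of
     full mass. *)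
  have AB1 : 1 <= p (A `&` B).
    have -> : A `&` B = A `\` (A `\` B) by rewrite setDD.
    rewrite fine_probD//; [|exact: measurableD].
    have : p (A `\` B) <= p (setT `\` B).
      apply: fine_prob_le; [exact: measurableD|exact: measurableD|].
      exact: setSD.
    rewrite (fine_probD P mB measurableT)// probability_setT /=.
    by move: FX FY; rewrite /cumulative -/A -/B; lra.
  apply: (le_trans AB1); apply: fine_prob_le; first exact: measurableI.
    exact: measurable_le_cst.
  by move=> t [Xt Yt] /=; rewrite lerD// ler_wpM2l// subr_ge0.
have a01 : 0 <= a < 1 by rewrite a0.
have [c1 ->] := shortfall_attained mX bX a01.
have [c2 ->] := shortfall_attained mY bY a01.
apply: (le_trans (shortfall_le mW bW (g * c1 + (1 - g) * c2) a01)).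
suff : stop_loss W (g * c1 + (1 - g) * c2) <=
    g * stop_loss X c1 + (1 - g) * stop_loss Y c2.
  move=> H; have : stop_loss W (g * c1 + (1 - g) * c2) / (1 - a) <=
    (g * stop_loss X c1 + (1 - g) * stop_loss Y c2) / (1 - a).
    by rewrite ler_wpM2r// invr_ge0; lra.
  by move: (1 - a)^-1 => i; lra.
rewrite -lee_fin EFinD !EFinM -(stop_lossE mW bW) -(stop_lossE mX bX).
rewrite -(stop_lossE mY bY).
have mmax (Z : T -> R) c : measurable_fun setT Z ->
    measurable_fun setT (fun t => (Num.max (Z t - c) 0)%:E).
  move=> mZ; apply/measurable_EFinP; apply: measurable_maxr => //.
  exact: measurable_funB.
have max0 (Z : T -> R) c t : (0 <= (Num.max (Z t - c) 0)%:E)%E.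
  by rewrite lee_fin le_max lexx orbT.
rewrite -ge0_integralZl//; [|exact: mmax].
rewrite -ge0_integralZl//; [|exact: mmax|by rewrite lee_fin subr_ge0].
rewrite -ge0_integralD//; first last.
- by apply: measurable_funeM; exact: mmax.
- by move=> t _; rewrite mule_ge0// lee_fin subr_ge0.
- by apply: measurable_funeM; exact: mmax.
- by move=> t _; rewrite mule_ge0// lee_fin.
apply: ge0_le_integral => //.
- exact: mmax.
- by apply: emeasurable_funD; apply: measurable_funeM; exact: mmax.
- move=> t _; rewrite -!EFinM -EFinD lee_fin.
  rewrite ge_max; apply/andP; split; last first.
    by rewrite addr_ge0// mulr_ge0// ?le_max ?lexx ?orbT// subr_ge0.
  have : g * (X t - c1) <= g * Num.max (X t - c1) 0.
    by rewrite ler_wpM2l// le_max lexx.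
  have : (1 - g) * (Y t - c2) <= (1 - g) * Num.max (Y t - c2) 0.
    by rewrite ler_wpM2l ?subr_ge0// le_max lexx.
  move: (Num.max (X t - c1) 0) (Num.max (Y t - c2) 0) => m n Hm Hn.
  have -> : W t = g * X t + (1 - g) * Y t by [].
  lra.
Qed.

End expected_shortfall.

(** * Cyclic rearrangements *)

Section rearrangement.
Context d (T : measurableType d) (R : realType) (P : probability T R).
Local Notation mu := lebesgue_measure.
Local Notation p A := (fine (P A)).

(* The rotation by [s] of the circle [`]a, 1]], and the identity on [`]0, a]]. *)
Definition cyclic_shift (a s u : R) :=
  if u <= a then u else if u + s <= 1 then u + s else u + s - (1 - a).

Lemma cyclic_shift_itv a s u : 0 <= a -> 0 <= s <= 1 - a -> 0 < u <= 1 ->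
  0 < cyclic_shift a s u <= 1.
Proof.
move=> a0 /andP[s0 s1] /andP[u0 u1]; rewrite /cyclic_shift.
case: ifPn => [_|]; first by rewrite u0.
rewrite -ltNge => au; case: ifPn => [us|]; first by rewrite us andbT; lra.
by rewrite -ltNge => us; apply/andP; split; lra.
Qed.

Lemma cyclic_shift_uniform (U : T -> R) a s :
  0 <= a -> 0 <= s <= 1 - a -> measurable_fun setT U ->
  (forall t, 0 < U t <= 1) -> (forall s, 0 <= s <= 1 -> cumulative P U s = s) ->
  measurable_fun setT (cyclic_shift a s \o U) /\
  forall s', 0 <= s' <= 1 -> cumulative P (cyclic_shift a s \o U) s' = s'.
Proof.
move=> a0 /andP[s0 s1] mU U01 FU.
have mle x : measurable [set t | U t <= x] by exact: measurable_le_cst.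
split.
  apply: measurable_fun_ifT => //=.
    by apply: (measurable_fun_bool true); rewrite setTI; exact: mle.
  apply: measurable_fun_ifT => //=.
  - apply: (measurable_fun_bool true); rewrite setTI.
    rewrite (_ : _ @^-1` _ = [set t | U t <= 1 - s])//.
    by apply/seteqP; split => t /=; rewrite lerBrDr.
  - exact: measurable_funD.
  - by apply: measurable_funB => //; exact: measurable_funD.
move=> v /andP[v0 v1]; rewrite /cumulative.
have [va|av] := leP v a.
  rewrite -[RHS]FU ?v0//; congr (fine (P _)); apply/seteqP.
  split => t /=; rewrite /cyclic_shift; last by move=> Uv; rewrite (le_trans Uv).
  case: ifPn => //; rewrite -ltNge => aU; case: ifPn; first by lra.
  by rewrite -ltNge; lra.
(* If [v >= a + s], the wrapped points all land below [v], and only []v - s, 1 - s]] is sent above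
   it. Otherwise, beyond []0, a]], only wrapped points can land below [v]. *)
have [asv|sva] := leP a (v - s).
  rewrite (_ : mkset _ =
      setT `\` ([set t | U t <= 1 - s] `\` [set t | U t <= v - s])).
    rewrite fine_probD//; last exact: measurableD.
    rewrite fine_probD//; last by move=> t /= Uv; lra.
    rewrite probability_setT /=.
    have F1 : cumulative P U (1 - s) = 1 - s by apply: FU; apply/andP; split; lra.
    have F2 : cumulative P U (v - s) = v - s by apply: FU; apply/andP; split; lra.
    by rewrite /cumulative in F1 F2; rewrite F1 F2; lra.
  apply/seteqP; split => t /=; have /andP[U0 U1] := U01 t.
    move=> H; split=> // -[] Us /negP; rewrite -ltNge => vU; move: H.
    rewrite /cyclic_shift; case: ifPn; first by lra.
    rewrite -ltNge => aU; case: ifPn; first by lra.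
    by rewrite -ltNge; lra.
  move=> [_ H]; rewrite /cyclic_shift; case: ifPn => [Ua|]; first by lra.
  rewrite -ltNge => aU; case: ifPn => [Us|].
    rewrite leNgt; apply/negP => vU; apply: H; split; first by lra.
    by apply/negP; rewrite -ltNge; lra.
  by rewrite -ltNge; lra.
rewrite (_ : mkset _ = [set t | U t <= a] `|`
    ([set t | U t <= v - s + 1 - a] `\` [set t | U t <= 1 - s])).
  rewrite fine_probU//; [|exact: measurableD|]; last first.
    apply/disj_set2P/seteqP; split => // t /= [Ua [_ /negP]].
    by rewrite -ltNge; lra.
  rewrite fine_probD//; last by move=> t /= Uv; lra.
  have F1 : cumulative P U (1 - s) = 1 - s by apply: FU; apply/andP; split; lra.
  have F2 : cumulative P U a = a by apply: FU; apply/andP; split; lra.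
  have F3 : cumulative P U (v - s + 1 - a) = v - s + 1 - a.
    by apply: FU; apply/andP; split; lra.
  by rewrite /cumulative in F1 F2 F3; rewrite F1 F2 F3; lra.
apply/seteqP; split => t /=; have /andP[U0 U1] := U01 t; rewrite /cyclic_shift.
  case: ifPn => [Ua _|]; first by left.
  rewrite -ltNge => aU; case: ifPn => [Us|]; first by lra.
  by rewrite -ltNge => Us H; right; split; [lra|apply/negP; rewrite -ltNge; lra].
case=> [Ua|[H /negP]]; first by rewrite Ua; lra.
rewrite -ltNge => Us; case: ifPn => [Ua|_]; first by lra.
by case: ifPn => [Us'|_]; lra.
Qed.

Context (X : T -> R) (M : R).
Context (mX : measurable_fun setT X) (bX : {ae P, forall t, `|X t| <= M}).
Local Notation q := (quantile P X).

(** Upper Riemann sum of the nondecreasing [q]: the cells are added from 1 leftwards, each with the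
    value at its right end. *)
Lemma tail_integral_riemann (h : R) j : 0 <= h -> j%:R * h <= 1 ->
  tail_integral P X (1 - j%:R * h) <= h * \sum_(i < j) q (1 - i%:R * h).
Proof.
move=> h0; elim: j => [|j IH] jh.
  rewrite big_ord0 mulr0 /tail_integral mul0r subr0 set_itvoc0.
  by rewrite Rintegral_set0.
have hj : j.+1%:R * h = j%:R * h + h by rewrite -natr1 mulrDl mul1r.
have jh0 : 0 <= j%:R * h by rewrite mulr_ge0.
rewrite /tail_integral (quantile_integral_split mX bX (b := 1 - j%:R * h)); [|lra..].
rewrite big_ord_recr /= mulrDr addrC; apply: lerD; first by apply: IH; lra.
have -> : h * q (1 - j%:R * h) =
    q (1 - j%:R * h) * (1 - j%:R * h - (1 - j.+1%:R * h)) by rewrite hj; ring.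
apply: (quantile_integral_le mX bX); first lra.
by move=> u /andP[u1 u2]; apply: (quantile_mono mX bX); lra.
Qed.

(* The [n] pieces of [`]a, 1]] are numbered from the right: piece [m] is
   [`]1 - (m + 1) h, 1 - m h]], and the shift by [k h] moves it to piece
   [m - k] modulo [n]. *)
Lemma cyclic_shift_piece n m k u a (h := (1 - a) / n%:R) : 0 <= a < 1 ->
  (k < n)%N -> (m < n)%N -> 1 - m.+1%:R * h < u <= 1 - m%:R * h ->
  let j := if (k <= m)%N then (m - k)%N else (m + n - k)%N in
  1 - j.+1%:R * h < cyclic_shift a (k%:R * h) u.
Proof.
move=> /andP[a0 a1] kn mn /andP[um um'].
have n0 : (0 : R) < n%:R by rewrite ltr0n (leq_ltn_trans _ kn).
have nh : n%:R * h = 1 - a by rewrite /h mulrC divfK ?gt_eqF.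
have h0 : 0 < h by rewrite divr_gt0//; lra.
have au : a < u.
  apply: le_lt_trans um; suff : m.+1%:R * h <= n%:R * h by lra.
  by rewrite ler_wpM2r ?ler_nat// ltW.
rewrite /cyclic_shift leNgt au /=.
have [km|mk] := leqP k m => /=.
  have -> : (m - k).+1%:R = m.+1%:R - k%:R :> R by rewrite -subSn// natrB// leqW.
  have km' : k%:R * h <= m%:R * h by rewrite ler_wpM2r ?ler_nat// ltW.
  by rewrite mulrBl; case: ifPn; [lra|rewrite -ltNge; lra].
have -> : (m + n - k).+1%:R = m.+1%:R + n%:R - k%:R :> R.
  rewrite -subSn; last by rewrite (leq_trans (ltnW kn))// leq_addl.
  by rewrite natrB ?leqW ?(leq_trans (ltnW kn)) ?leq_addl// -addSn natrD.
have km' : m.+1%:R * h <= k%:R * h by rewrite ler_wpM2r ?ler_nat// ltW.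
by rewrite mulrBl mulrDl; case: ifPn; [lra|lra].
Qed.

(** The [n] shifts of [u] visit each piece once, and there [q] is at least its value at the left
    end, which is the right end of the next piece. So the sum dominates the upper Riemann sum up to
    two terms: [q 1 <= M] is missing, and the leftmost piece contributes at least [- M]. Hence the
    [2 * M]. *)
Lemma mean_cyclic_shift_ge N a u : 0 <= a < 1 -> a < u <= 1 ->
  shortfall P X a - 2 * M / N.+1%:R <= N.+1%:R^-1 *
    \sum_(k < N.+1) q (cyclic_shift a (k%:R * ((1 - a) / N.+1%:R)) u).
Proof.
move=> a01 /andP[au u1]; have /andP[a0 a1] := a01.
set n := N.+1; set h := (1 - a) / n%:R.
have n0 : (0 : R) < n%:R by rewrite ltr0n.
have nh : n%:R * h = 1 - a by rewrite /h mulrC divfK ?gt_eqF.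
have h0 : 0 < h by rewrite divr_gt0//; lra.
have piece j : (j < n)%N -> j.+1%:R * h <= 1 - a.
  by move=> jn; rewrite -nh ler_wpM2r ?ler_nat// ltW.
pose m := Num.truncn ((1 - u) / h).
have /truncn_itv/andP[m1 m2] : 0 <= (1 - u) / h by apply: divr_ge0; lra.
have mn : (m < n)%N.
  rewrite -(ltr_nat R); apply: (le_lt_trans m1).
  by rewrite ltr_pdivrMr// nh; lra.
have {}m1 : m%:R * h <= 1 - u by rewrite -ler_pdivlMr.
have {}m2 : 1 - u < m.+1%:R * h by rewrite -ltr_pdivrMr.
(* The leftmost piece ends at [a], which may be 0, where [q] is junk; hence the default [- M]. *)
pose g j := if (j < N)%N then q (1 - j.+1%:R * h) else - M.
have gq j v : (j < n)%N -> 1 - j.+1%:R * h < v -> 0 < v <= 1 -> g j <= q v.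
  move=> jn jv v01; rewrite /g; case: ifPn => jN.
    have /andP[v0 v1] := v01; apply: (quantile_mono mX bX) => //; last exact: ltW.
    have : j.+1%:R * h < n%:R * h by rewrite ltr_pM2r// ltr_nat.
    lra.
  by have /andP[] := quantile_itv mX bX v01.
(* [w k] is the piece reached by the [k]-th shift; its injectivity allows reindexing the sum over
   pieces by shifts. *)
pose w (k : 'I_n) : 'I_n :=
  inord (if (k <= m)%N then (m - k)%N else (m + n - k)%N).
have wE k : w k = (if (k <= m)%N then (m - k)%N else (m + n - k)%N) :> nat.
  by rewrite inordK//; have := ltn_ord k; move: mn; rewrite /n; case: ifP; lia.
have w_inj : injective w.
  move=> k l /(congr1 val) /=; rewrite !wE => kl; apply/val_inj => /=.
  have := ltn_ord k; have := ltn_ord l; move: mn kl; rewrite /n.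
  by case: ifP; case: ifP; lia.
have sum_ge : \sum_(j < n) g j <= \sum_(k < n) q (cyclic_shift a (k%:R * h) u).
  rewrite (reindex_inj w_inj); apply: ler_sum => k _; apply: gq => //.
    rewrite wE; apply: cyclic_shift_piece => //.
    by apply/andP; rewrite -/h; split; lra.
  apply: cyclic_shift_itv => //; last by rewrite u1 andbT; lra.
  apply/andP; split; first by apply: mulr_ge0 => //; exact: ltW.
  apply: le_trans (piece k (ltn_ord k)).
  by rewrite ler_wpM2r ?ler_nat// ltW.
have nh1 : n%:R * h <= 1 by lra.
have := tail_integral_riemann (ltW h0) nh1.
rewrite nh (_ : 1 - (1 - a) = a); last lra.
have -> : \sum_(i < n) q (1 - i%:R * h) = q 1 + \sum_(i < N) g i.
  rewrite big_ord_recl /= mul0r subr0; congr (_ + _).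
  by apply: eq_bigr => i _; rewrite /g ltn_ord.
move: sum_ge; rewrite big_ord_recr /= {2}/g ltnn.
move: (\sum_(i < N) g i) (\sum_(k < n) _) => S Z SZ tail.
have q1 : q 1 <= M.
  have H01 : 0 < (1 : R) <= 1 by rewrite ltr01 lexx.
  by have /andP[] := quantile_itv mX bX H01.
rewrite /shortfall a1 -nh invfM.
move: (tail_integral P X a) tail => J tail.
have -> : n%:R^-1 / h * J - 2 * M / n%:R = n%:R^-1 * (h^-1 * J - 2 * M) by ring.
rewrite ler_pM2l ?invr_gt0//.
suff : h^-1 * J <= S + M by lra.
rewrite mulrC ler_pdivrMr// mulrC; apply: (le_trans tail).
by rewrite ler_pM2l//; lra.
Qed.

End rearrangement.

(** * Minimality *)

Section minimality.
Context d (T : measurableType d) (R : realType) (P : probability T R).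
Local Notation p A := (fine (P A)).

Lemma lee_real_lt (a b : \bar R) :
  (forall y : R, (y%:E < a)%E -> (y%:E <= b)%E) -> (a <= b)%E.
Proof.
move=> H; rewrite leNgt; apply/negP; move: a b H => [a| |] [b| |] // H ab.
- have := H ((a + b) / 2); rewrite !lte_fin !lee_fin in ab *.
  by move=> /(_ (ltac:(lra))); lra.
- by have := H (a - 1); rewrite lte_fin leeNy_eq; move=> /(_ (ltac:(lra))).
- by have := H (b + 1); rewrite ltry lee_fin => /(_ isT); lra.
- by have := H 0; rewrite ltry leeNy_eq => /(_ isT).
Qed.

(** Induction: the mean of [n + 2] terms mixes the mean of the first [n + 1], with weight
    [(n + 1) / (n + 2)], and the last term. *)
Lemma quasi_convex_mean (rho : (T -> R) -> \bar R) (Xs : nat -> T -> R) c n :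
  quasi_convex P rho -> (forall k, Linf P (Xs k)) ->
  (forall k, (rho (Xs k) <= c)%E) ->
  Linf P (fun t => n.+1%:R^-1 * \sum_(k < n.+1) Xs k t) /\
  (rho (fun t => (n.+1%:R^-1 * \sum_(k < n.+1) Xs k t)%R) <= c)%E.
Proof.
move=> qc LX Xc; elim: n => [|n [IHL IHc]].
  rewrite (_ : (fun t => _) = Xs 0%N)//.
  by apply/funext => t; rewrite big_ord_recl big_ord0 addr0 invr1 mul1r.
set Y := fun t => _ in IHL IHc.
pose g : R := n.+1%:R / n.+2%:R.
have n2 : n.+2%:R = n.+1%:R + 1 :> R by rewrite natr1.
have n1 : (0 : R) < n.+1%:R by rewrite ltr0n.
have -> : (fun t => n.+2%:R^-1 * \sum_(k < n.+2) Xs k t) =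
    (fun t => g * Y t + (1 - g) * Xs n.+1 t).
  apply/funext => t; rewrite big_ord_recr /= /g /Y.
  move: (\sum_(k < n.+1) _) => S; rewrite n2; field.
  by apply/andP; split; apply: lt0r_neq0; lra.
split; first exact: LinfD.
apply: le_trans (qc _ _ IHL (LX n.+1) g _) _.
  rewrite divr_ge0//= ler_pdivrMr ?mul1r ?ltr0n//.
  by rewrite ler_nat.
by rewrite ge_max IHc Xc.
Qed.

Lemma cumulative_eq_distr X Y : eq_distr P X Y ->
  forall x, P [set t | X t <= x] = P [set t | Y t <= x].
Proof.
move=> XY x; have := XY `]-oo, x]%classic (measurable_itv _).
by congr (P _ = P _); apply/seteqP; split => t /=; rewrite in_itv.
Qed.

Lemma ES_eq_distr a X Y : eq_distr P X Y -> ES P a X = ES P a Y.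
Proof.
move=> /cumulative_eq_distr XY.
have VE b : VaR P b X = VaR P b Y.
  by rewrite /VaR; congr ereal_inf; congr image; apply/funext => x /=; rewrite XY.
rewrite /ES VE; case: ifP => // _; congr (_ * _)%E.
by apply: eq_integral => u _.
Qed.

Lemma ES_LinfE X a : Linf P X -> 0 <= a <= 1 -> ES P a X = (shortfall P X a)%:E.
Proof. by move=> [mX [M bX]] a01; rewrite (ES_shortfall mX bX a01). Qed.

(** [Z] is the mean of the shifted copies. It exceeds [y] wherever [U > a], so [{Z <= y}] lies in
    [{U <= a}], an event of mass [a]. *)
Lemma averaged_copy (hP : atomless P) X a y : 0 <= a < 1 -> Linf P X ->
  y < shortfall P X a ->
  exists Z, [/\ Linf P Z, cumulative P Z y <= a &
    forall rho, quasi_convex P rho -> law_invariant P rho ->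
      (rho Z <= rho X)%E].
Proof.
move=> a01 LX ye; have [mX [M bX]] := LX; have /andP[a0 a1] := a01.
have [U [mU U01 FU]] := uniform_exists hP.
have M0 := bound_ge0 mX bX.
pose N := Num.truncn (2 * M / (shortfall P X a - y)).
have NM : 2 * M / N.+1%:R < shortfall P X a - y.
  rewrite ltr_pdivrMr// [ltRHS]mulrC -ltr_pdivrMr ?subr_gt0//.
  exact: truncnS_gt.
pose V k := cyclic_shift a (k%:R * ((1 - a) / N.+1%:R)) \o U.
(* Padding with [U] makes every term of the infinite sequence a copy of [X]. *)
pose Xs k := quantile P X \o (if (k < N.+1)%N then V k else U).
have VU k : (k < N.+1)%N -> [/\ measurable_fun setT (V k),
    forall t, 0 < V k t <= 1 & forall s, 0 <= s <= 1 -> cumulative P (V k) s = s].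
  move=> kN; have s01 : 0 <= k%:R * ((1 - a) / N.+1%:R) <= 1 - a.
    apply/andP; split; first by rewrite mulr_ge0// divr_ge0//; lra.
    rewrite mulrA ler_pdivrMr// mulrC ler_wpM2l ?ler_nat//; last exact: ltnW.
    lra.
  have [mV FV] := cyclic_shift_uniform a0 s01 mU U01 FU.
  by split => // t; exact: cyclic_shift_itv.
have XsP k : measurable_fun setT (Xs k) /\ eq_distr P X (Xs k).
  rewrite /Xs; case: ifPn => [/VU[mV V01 FV]|_].
    split; first by apply: measurableT_comp => //; exact: measurable_quantile bX _.
    exact: (quantile_uniform_distr mX bX).
  split; first by apply: measurableT_comp => //; exact: measurable_quantile bX _.
  exact: (quantile_uniform_distr mX bX).
have LXs k : Linf P (Xs k).
  split; first by have [] := XsP k.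
  exists M; apply: aeW => t; exact: (quantile_norm mX bX).
pose Z t := N.+1%:R^-1 * \sum_(k < N.+1) Xs k t.
have LZ : Linf P Z.
  (* Boundedness of a mean is independent of the functional, so the constant one gives it. *)
  have qc0 : quasi_convex P (fun=> 0%E) by move=> *; rewrite le_max lexx.
  by have [] := quasi_convex_mean N qc0 LXs (fun=> lexx 0%E).
exists Z; split => //.
- have a01' : 0 <= a <= 1 by rewrite a0 ltW.
  rewrite -[leRHS]FU//; apply: fine_prob_le.
  + by apply: measurable_le_cst; have [] := LZ.
  + exact: measurable_le_cst.
  + move=> t /= Zy; rewrite leNgt; apply/negP => aU.
    have /andP[_ U1] := U01 t.
    have aU1 : a < U t <= 1 by rewrite aU.
    have := mean_cyclic_shift_ge mX bX N a01 aU1.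
    have -> : N.+1%:R^-1 * \sum_(k < N.+1) quantile P X
        (cyclic_shift a (k%:R * ((1 - a) / N.+1%:R)) (U t)) = Z t.
      by congr (_ * _); apply: eq_bigr => k _; rewrite /Xs ltn_ord.
    by move=> /le_trans/(_ Zy); rewrite leNgt ltrBrDr -ltrBrDl NM.
- move=> rho qc li; have [] // := quasi_convex_mean N qc LXs (c := rho X).
  by move=> k; rewrite (li X (Xs k)) //; have [] := XsP k.
Qed.

(** * The Lambda-Expected Shortfall *)

Context (L : R -> R) (dL : decreasing L) (L01 : forall x, 0 <= L x <= 1).

Lemma ES_L_quasi_convex : quasi_convex P (ES_L P L).
Proof.
move=> X Y LX LY g g01; apply: ge_ereal_sup => _ [x _ <-].
have ub Z : (mine (ES P (L x) Z) x%:E <= ES_L P L Z)%E.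
  by apply: ereal_sup_ubound; exists x.
have := shortfall_quasi_convex (L01 x) LX LY g01.
rewrite le_max => /orP[le1|le1]; rewrite le_max; apply/orP; [left|right];
  apply: le_trans (ub _); rewrite !ES_LinfE//; try exact: LinfD;
  by rewrite le_min !ge_min lexx orbT andbT lee_fin le1.
Qed.

Lemma ES_L_law_invariant : law_invariant P (ES_L P L).
Proof.
move=> X Y LX LY XY; rewrite /ES_L; congr ereal_sup.
by congr image; apply/funext => x; rewrite (ES_eq_distr _ XY).
Qed.

Lemma ES_L_ge_real X x : Linf P X -> x <= shortfall P X (L x) ->
  (x%:E <= ES_L P L X)%E.
Proof.
move=> LX xe; apply: le_trans (ereal_sup_ubound _); last by exists x.
by rewrite ES_LinfE// le_min lexx andbT lee_fin.
Qed.

(** The common part of (i) and (ii), which differ in the level [a] they can offer. *)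
Lemma ES_L_min (hP : atomless P) (lb : (T -> R) -> \bar R) :
  ge_on_Linf P (ES_L P L) lb ->
  (forall X x y, Linf P X -> y < x -> y < shortfall P X (L x) ->
    exists a, [/\ 0 <= a < 1, y < shortfall P X a &
      forall Z, Linf P Z -> cumulative P Z y <= a -> (y%:E <= lb Z)%E]) ->
  is_min_qc_li_above P lb (ES_L P L).
Proof.
move=> lbES H; split => //; [exact: ES_L_quasi_convex|exact: ES_L_law_invariant|].
move=> rho qc li rholb X LX; apply: ge_ereal_sup => _ [x _ <-].
apply: lee_real_lt => y; rewrite ES_LinfE// lt_min !lte_fin => /andP[ye yx].
have [a [a01 ya HZ]] := H X x y LX yx ye.
have [Z [LZ FZ rhoZ]] := averaged_copy hP a01 LX ya.
apply: le_trans (rhoZ _ qc li); apply: le_trans (rholb _ LZ).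
exact: HZ.
Qed.

(** [ES (L x) X] decreases in [x] while [x] increases, so each minimum is below each maximum. A real
    [y] strictly between the supremum and the infimum would give both [ES (L y) X < y] and
    [ES (L y) X > y]. *)
Lemma ES_L_inf X : Linf P X ->
  ES_L P L X = ereal_inf [set maxe (ES P (L x) X) x%:E | x in [set: R]].
Proof.
move=> LX; have [mX [M bX]] := LX.
have e_mono x y : x <= y -> shortfall P X (L y) <= shortfall P X (L x).
  move=> xy; have /andP[L0 _] := L01 y; have /andP[_ L1] := L01 x.
  by apply: (shortfall_mono mX bX) => //; exact: dL.
apply/eqP; rewrite eq_le; apply/andP; split.
  apply: ge_ereal_sup => _ [x _ <-]; apply: le_ereal_inf_tmp => _ [y _ <-].
  rewrite !ES_LinfE// -EFin_min -EFin_max lee_fin ge_min !le_max.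
  by case: (leP x y) => xy; [rewrite !orbT|rewrite (e_mono _ _ (ltW xy))].
apply: lee_real_lt => y yinf; rewrite leNgt; apply/negP => supy.
have : (mine (ES P (L y) X) y%:E < y%:E)%E.
  by apply: le_lt_trans supy; apply: ereal_sup_ubound; exists y.
rewrite ES_LinfE// gt_min ltxx orbF lte_fin => ey.
have : (y%:E < maxe (ES P (L y) X) y%:E)%E.
  by apply: lt_le_trans yinf _; apply: ereal_inf_lbound; exists y.
by rewrite ES_LinfE// lt_max ltxx orbF lte_fin ltNge (ltW ey).
Qed.

End minimality.

Theorem theorem2 (d : measure_display) (T : measurableType d) (R : realType)
  (P : probability T R) (hP : atomless P) :
  (* (i) *)
  (forall L : R -> R, decreasing L -> (forall x, 0 < L x <= 1) ->
     is_min_qc_li_above P (VaR_L P L) (ES_L P L)) /\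
  (* (ii) *)
  (forall L : R -> R, decreasing L -> (forall x, 0 <= L x < 1) ->
     is_min_qc_li_above P (VaRplus_L P L) (ES_L P L)) /\
  (* inf representation *)
  (forall L : R -> R, decreasing L -> (forall x, 0 <= L x <= 1) ->
     forall X : T -> R, Linf P X ->
       ES_L P L X = ereal_inf [set maxe (ES P (L x) X) x%:E | x in [set: R]]).
Proof.
have itvW (L : R -> R) : (forall x, 0 < L x <= 1) -> forall x, 0 <= L x <= 1.
  by move=> H x; have /andP[/ltW -> ->] := H x.
have itvV (L : R -> R) : (forall x, 0 <= L x < 1) -> forall x, 0 <= L x <= 1.
  by move=> H x; have /andP[-> /ltW ->] := H x.
split; [|split].
- move=> L dL L01; apply: ES_L_min => //; first exact: itvW.
  + move=> X LX; have [mX [M bX]] := LX.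
    (* Below the Lambda-VaR, [F y < L y]; hence quantiles of level at least [L y] are at least [y],
       and so is their average. *)
    apply: lee_real_lt => y yV; apply: ES_L_ge_real => //; first exact: itvW.
    have Fy : cumulative P X y < L y.
      rewrite ltNge; apply/negP => LF; move: yV; apply/negP; rewrite -leNgt.
      apply: ereal_inf_lbound; exists y => //=.
      by rewrite -(fine_probK P (measurable_le_cst y mX)) lee_fin.
    have /andP[L0 L1] := L01 y.
    have qLy u : L y <= u -> u <= 1 -> y <= quantile P X u.
      move=> Lu u1; rewrite leNgt; apply/negP => /ltW.
      rewrite (quantile_le mX bX) ?u1 ?(lt_le_trans L0 Lu)//; lra.
    apply: (shortfall_ge mX bX); first by rewrite ltW.
      by move=> u /andP[/ltW Lu u1]; exact: qLy.
    exact: qLy.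
  + move=> X x y [mX [M bX]] yx ye.
    have [a [a0 aL ya]] := shortfall_lsc mX bX (L01 x) ye.
    have /andP[_ L1] := L01 x.
    exists a; split => //; first by rewrite a0 (lt_le_trans aL).
    (* Some [z < y] in the infimum set would give [L x <= L z <= F z <= F y <= a < L x], [F] being
       the distribution function of [Z]. *)
    move=> Z [mZ _] Fa; apply: le_ereal_inf_tmp => _ [z /= + <-].
    rewrite -(fine_probK P (measurable_le_cst z mZ)) !lee_fin => Lz.
    rewrite leNgt; apply/negP => zy.
    have := cumulative_le P mZ (ltW zy); have := dL z x (ltW (lt_trans zy yx)).
    rewrite {1}/cumulative; lra.
- move=> L dL L01; apply: ES_L_min => //; first exact: itvV.
  + move=> X LX; have [mX [M bX]] := LX.
    apply: lee_real_lt => y yV; apply: ES_L_ge_real => //; first exact: itvV.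
    have Fy : cumulative P X y <= L y.
      rewrite leNgt; apply/negP => LF; move: yV; apply/negP; rewrite -leNgt.
      apply: ereal_inf_lbound; exists y => //=.
      by rewrite -(fine_probK P (measurable_le_cst y mX)) lte_fin.
    have /andP[L0 L1] := L01 y.
    (* Only [F y <= L y] is known here, so the level must exceed [L y] strictly; [L y < 1] still
       admits level 1. *)
    have qLy u : L y < u -> u <= 1 -> y <= quantile P X u.
      move=> Lu u1; rewrite leNgt; apply/negP => /ltW.
      rewrite (quantile_le mX bX) ?u1 ?(le_lt_trans L0 Lu)//; lra.
    apply: (shortfall_ge mX bX); first by rewrite L0 ltW.
      by move=> u /andP[Lu u1]; exact: qLy.
    exact: qLy.
  (* The strict inequality in [VaRplus_L] lets the level be [L x] itself: [z < y] would give
     [L x <= L z < F z <= L x]. *)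
  + move=> X x y _ yx ye; exists (L x); split => //.
    move=> Z [mZ _] Fa; apply: le_ereal_inf_tmp => _ [z /= + <-].
    rewrite -(fine_probK P (measurable_le_cst z mZ)) lte_fin lee_fin => Lz.
    rewrite leNgt; apply/negP => zy.
    have := cumulative_le P mZ (ltW zy); have := dL z x (ltW (lt_trans zy yx)).
    rewrite {1}/cumulative; lra.
- by move=> L dL L01 X LX; exact: ES_L_inf.
Qed.
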